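(* Let $\mathbb F$ be an algebraically closed field of characteristic different from $2$ and let $n\ge1$. The derivations $\mathfrak D$ of $\mathbf E_n$ are of the form (as matrices in the basis $e_1,\dots,e_n$) $$\mathfrak D=\begin{pmatrix}0&0\\0&D_0\end{pmatrix},$$ where $D_0=-D_0^{\mathrm T}$ is an $(n-1)\times(n-1)$ matrix. Moreover, $\dim\mathfrak{Der}(\mathbf E_n)=\frac{(n-1)(n-2)}{2}$.
   Context: $\mathbf E_n$ is the $n$-dimensional algebra over $\mathbb F$ with basis $e_1,\dots,e_n$ and products $e_1^2=\dots=e_n^2=e_1$, $e_ie_j=0$ for $i\ne j$. A derivation is a linear map $\mathfrak D$ with $\mathfrak D(xy)=\mathfrak D(x)y+x\mathfrak D(y)$; its matrix $(d_{ij})$ is given by $\mathfrak D(e_j)=\sum_i d_{ij}e_i$. $\mathfrak{Der}(\mathbf E_n)$ is the vector space of all derivations. *)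

(* Defs.v *)
From HB Require Import structures.
From mathcomp Require Import all_boot all_order all_algebra.

Set Implicit Arguments.
Unset Strict Implicit.
Unset Printing Implicit Defensive.

Import GRing.Theory.
Local Open Scope ring_scope.

Section AlgebraE.
Variables (F : fieldType) (m : nat).

(* E_n with n = m.+1 >= 1, as columns of coordinates; since ordinals start at
   0, e_1 is [Ebasis ord0]. *)
Local Notation En := 'cV[F]_m.+1.

Definition Ebasis (i : 'I_m.+1) : En := delta_mx i 0.

Definition Etable (i j : 'I_m.+1) : En := if i == j then Ebasis ord0 else 0.

Definition Emul (x y : En) : En :=
  \sum_(i < m.+1) \sum_(j < m.+1) (x i 0 * y j 0) *: Etable i j.

Definition derivation (D : 'End(En)) : Prop :=
  forall x y : En, D (Emul x y) = Emul (D x) y + Emul x (D y).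

(* Images of basis vectors are columns, unlike in the library's [mxof]: see
   [Emx_basis]. *)
Definition Emx (D : 'End(En)) : 'M[F]_m.+1 :=
  \matrix_(i, j) D (Ebasis j) i 0.

Lemma Emul_basis i j : Emul (Ebasis i) (Ebasis j) = Etable i j.
Proof.
rewrite /Emul (bigD1 i) //= [X in _ + X]big1 ?addr0 => [|k /negbTE ki].
  rewrite (bigD1 j) //= [X in _ + X]big1 ?addr0 => [|k /negbTE kj].
    by rewrite !mxE !eqxx mulr1 scale1r.
  by rewrite !mxE kj mulr0 scale0r.
by rewrite big1 // => l _; rewrite !mxE ki mul0r scale0r.
Qed.

Lemma Ebasis_sum (x : En) : x = \sum_i x i 0 *: Ebasis i.
Proof.
by rewrite [LHS]matrix_sum_delta; apply: eq_bigr => i _; rewrite big_ord1.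
Qed.

Lemma Emx_basis (D : 'End(En)) j :
  D (Ebasis j) = \sum_i Emx D i j *: Ebasis i.
Proof. by rewrite [LHS]Ebasis_sum; apply: eq_bigr => i _; rewrite mxE. Qed.

Lemma Emul_linearl z : linear (Emul^~ z).
Proof.
move=> a x y; rewrite /Emul scaler_sumr -big_split; apply: eq_bigr => i _ /=.
rewrite scaler_sumr -big_split; apply: eq_bigr => j _ /=.
by rewrite !mxE scalerA -scalerDl mulrDl mulrA.
Qed.

Lemma Emul_linearr x : linear (Emul x).
Proof.
move=> a y z; rewrite /Emul scaler_sumr -big_split; apply: eq_bigr => i _ /=.
rewrite scaler_sumr -big_split; apply: eq_bigr => j _ /=.
by rewrite !mxE scalerA -scalerDl mulrDr mulrCA.
Qed.

Definition Edefect (x y : En) (D : 'End(En)) : En :=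
  D (Emul x y) - (Emul (D x) y + Emul x (D y)).

Fact Edefect_linear x y : linear (Edefect x y).
Proof.
move=> a D1 D2; rewrite /Edefect !lfunE /= !lfunE /= Emul_linearl Emul_linearr.
by rewrite addrACA -scalerDr opprD addrACA -scalerBr.
Qed.

HB.instance Definition _ x y :=
  GRing.isLinear.Build F 'End(En) En *:%R (Edefect x y) (Edefect_linear x y).

Fact Edefect_linearl (D : 'End(En)) y : linear (fun x => Edefect x y D).
Proof.
move=> a u v; rewrite /Edefect Emul_linearl !linearP /= !Emul_linearl.
by rewrite addrACA -scalerDr opprD addrACA -scalerBr.
Qed.

Fact Edefect_linearr (D : 'End(En)) x : linear (fun y => Edefect x y D).
Proof.
move=> a u v; rewrite /Edefect Emul_linearr !linearP /= !Emul_linearr.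
by rewrite addrACA -scalerDr opprD addrACA -scalerBr.
Qed.

Fact linear_basis0 (f : En -> En) :
  linear f -> (forall i, f (Ebasis i) = 0) -> forall x, f x = 0.
Proof.
move=> lf f0 x; pose g : {linear En -> En} :=
  HB.pack f (GRing.isLinear.Build F En En *:%R f lf).
rewrite -[f]/(g : En -> En) [x]Ebasis_sum linear_sum big1 // => i _.
by rewrite linearZ /= f0 scaler0.
Qed.

(* By bilinearity it is enough to impose the Leibniz rule on pairs of basis
   vectors; [DerP] shows that the members are exactly the derivations. *)
Definition Der : {vspace 'End(En)} :=
  (\bigcap_(ij : 'I_m.+1 * 'I_m.+1)
     lker (linfun (Edefect (Ebasis ij.1) (Ebasis ij.2))))%VS.

Lemma DerP (D : 'End(En)) : reflect (derivation D) (D \in Der).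
Proof.
apply: (iffP idP) => [/subv_bigcapP dD x y | dD].
  apply/eqP; rewrite -subr_eq0; apply/eqP; rewrite -[LHS]/(Edefect x y D).
  apply: (linear_basis0 (Edefect_linearl D y)) => i.
  apply: (linear_basis0 (Edefect_linearr D (Ebasis i))) => j.
  by have := dD (i, j) isT; rewrite -memvE memv_ker lfunE => /eqP.
apply/subv_bigcapP => ij _.
by rewrite -memvE memv_ker lfunE /= /Edefect dD subrr.
Qed.

End AlgebraE.

Arguments Der : clear implicits.

(* Main.v *)
(* Since [x y = (x^T y) e_1], the Leibniz rule for [D] with matrix [A] reads
   [A e_1 (x^T y) = e_1 (x^T (A^T + A) y)].  Taking [x = y = e_1] gives
   [d_11 = 2 d_11 = 0]; the other basis vectors then give [A e_1 = 0] and
   [A^T = - A].  The entries of [D_0] below the diagonal are free parameters,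
   as the diagonal vanishes in characteristic different from 2. *)
From HB Require Import structures.
Require Import Defs.
From mathcomp Require Import all_boot all_order all_algebra.

Import GRing.Theory.
Local Open Scope ring_scope.

Lemma skew_mx_diag (F : fieldType) n (A : 'M[F]_n) i :
  2%N \notin [pchar F] -> A = - A^T -> A i i = 0.
Proof.
move=> hF /matrixP/(_ i i); rewrite !mxE => /eqP.
rewrite -addr_eq0 -mulr2n -mulr_natr mulf_eq0 => /orP[/eqP //|two0].
by rewrite inE two0 in hF.
Qed.

(** Group the pairs by their larger component [j]: it admits [j] smaller partners, and summing [j]
    over [j < n] gives the binomial coefficient. *)
Lemma card_gtn_pairs n :
  #|{: {p : 'I_n * 'I_n | (p.2 < p.1)%N}}| = 'C(n, 2).
Proof.
rewrite card_sig -sum1_card -bin2_sum big_mkord.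
rewrite -(pair_big_dep xpredT (fun j i : 'I_n => (i < j)%N)
  (fun _ _ => 1%N)) /=.
apply: eq_bigr => j _.
by rewrite -(big_ord_widen n (fun=> 1%N) (ltnW (ltn_ord j))) sum1_card card_ord.
Qed.

Section Derivations.
Variables (F : fieldType) (m : nat).
Local Notation En := 'cV[F]_m.+1.

Lemma Emul_mx (x y : En) : Emul x y = Ebasis F ord0 *m (x^T *m y).
Proof.
rewrite [x^T *m y]mx11_scalar mul_mx_scalar mxE scaler_suml.
apply: eq_bigr => i _; rewrite (bigD1 i) //= [X in _ + X]big1 ?addr0.
  by rewrite /Etable eqxx mxE.
by move=> j /negbTE ji; rewrite /Etable eq_sym ji scaler0.
Qed.

Lemma Emx_mul (D : 'End(En)) x : D x = Emx D *m x.
Proof.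
rewrite [x in LHS]Ebasis_sum linear_sum; apply/colP => i.
rewrite summxE mxE; apply: eq_bigr => j _.
by rewrite linearZ !mxE mulrC.
Qed.

Lemma derivation_mx (D : 'End(En)) :
  derivation D <-> (forall i, Emx D i ord0 = 0) /\ Emx D = - (Emx D)^T.
Proof.
move: (Emx D) (Emx_mul D) => A DE.
have AE i j : (A *m Ebasis F j) i 0 = A i j by rewrite -colE mxE.
split=> [dD | [A0 skewA] x y]; last first.
  (* For the converse both sides of the Leibniz rule vanish: the left because [A] kills the first
     basis vector, the right because [A^T + A = 0]. *)
  have {}A0 : A *m Ebasis F ord0 = 0.
    by apply/colP => i; rewrite AE A0 mxE.
  rewrite !Emul_mx !DE mulmxA A0 mul0mx -mulmxDr trmx_mul.
  by rewrite -mulmxA -mulmxDr -mulmxDl {2}skewA subrr mul0mx !mulmx0.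
have BE (M N : 'M[F]_1) i :
    (Ebasis F ord0 *m (M + N)) i 0 = (M 0 0 + N 0 0) *+ (i == ord0).
  by rewrite mxE big_ord1 !mxE andbT mulr_natl.
have BTE (x : En) j : ((Ebasis F j)^T *m x) 0 0 = x j 0.
  by rewrite trmx_delta -rowE mxE.
have EBT (x : En) k : (x^T *m Ebasis F k) 0 0 = x k 0 by rewrite -colE !mxE.
(* Coordinate [i] of the Leibniz rule at the basis vectors [j] and [k]; the boolean multiples play
   the role of Kronecker deltas. *)
have leib i j k :
    A i ord0 *+ (j == k) = (A k j + A j k) *+ (i == ord0).
  have /colP/(_ i) := dD (Ebasis F j) (Ebasis F k).
  rewrite !Emul_mx !DE -mulmxDr BE EBT BTE !AE => <-.
 rewrite [_^T *m _]mx11_scalar BTE mul_mx_scalar -scalemxAr mxE AE mxE.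
  by rewrite andbT mulr_natl.
have A00 : A ord0 ord0 = 0.
  have := leib ord0 ord0 ord0; rewrite !eqxx !mulr1n => /esym/eqP.
  by rewrite addrC -subr_eq0 addrK => /eqP.
(* Off the first coordinate, with [j = k = ord0], the right side of [leib] vanishes. *)
have A0 i : A i ord0 = 0.
  have [-> //|/negbTE i0] := eqVneq i ord0.
  by have := leib i ord0 ord0; rewrite i0.
(* In coordinate [ord0] the left side of [leib] is a multiple of an entry of the first column, now
   known to be zero. *)
split=> //; apply/matrixP => i j; rewrite !mxE; apply/eqP; rewrite -addr_eq0.
by have := leib ord0 j i; rewrite A0 mul0rn eqxx mulr1n => <-.
Qed.

(** A skew matrix with zero first column also has zero first row, so only the lower right block
    survives, and it inherits skewness. *)
Lemma derivation_block (D : 'End(En)) :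
  derivation D <->
  exists2 D0 : 'M[F]_m,
    D0 = - D0^T & Emx D = block_mx (0 : 'M_1) 0 0 D0.
Proof.
apply: iff_trans (derivation_mx D) _.
(* Block lemmas read [m.+1] as [1 + m], so the first index must be seen as a left shift. *)
have ord0E : (ord0 : 'I_m.+1) = lshift m (ord0 : 'I_1) by apply: val_inj.
move: (Emx D) => A; split=> [[A0 skewA] | [D0 skewD0 ->]]; last first.
  split=> [i|].
    rewrite ord0E; case: (@split_ordP 1 m i) => k ->.
      by rewrite (@block_mxEul _ 1 m 1 m) mxE.
    by rewrite (@block_mxEdl _ 1 m 1 m) mxE.
  rewrite (@tr_block_mx _ 1 m 1 m) (@opp_block_mx _ 1 m 1 m).
  by rewrite !trmx0 !oppr0 -skewD0.
have A0r j : A ord0 j = 0 by rewrite skewA !mxE A0 oppr0.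
exists (drsubmx (A : 'M_(1 + m))).
  by apply/matrixP => i j; rewrite !mxE {1}skewA !mxE.
rewrite -[LHS](@submxK _ 1 m 1 m).
congr (@block_mx _ 1 m 1 m _ _ _ _); apply/matrixP => i j.
- by rewrite !mxE !ord1 -ord0E A0.
- by rewrite !mxE !ord1 -ord0E A0r.
- by rewrite !mxE !ord1 -ord0E A0.
Qed.

(** The linear map [low], which reads the entries of the lower right block strictly below its
    diagonal, restricts to an isomorphism from [Der F m] onto the functions on [S]. *)
Lemma dim_Der : 2%N \notin [pchar F] -> \dim (Der F m) = 'C(m, 2).
Proof.
move=> hF; pose S : Type := {p : 'I_m * 'I_m | (p.2 < p.1)%N}.
pose low (D : 'End(En)) : {ffun S -> F^o} :=
  [ffun p => Emx D (rshift 1 (val p).1) (rshift 1 (val p).2)].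
have low_linear : linear low.
  move=> a D1 D2; apply/ffunP => p.
  by rewrite !ffunE !mxE !lfunE /= !lfunE !mxE.
pose lowL : {linear 'End(En) -> {ffun S -> F^o}} :=
  HB.pack low (GRing.isLinear.Build F _ _ *:%R low low_linear).
have lowE D : linfun lowL D = low D by rewrite lfunE.
rewrite -(@limg_dim_eq _ _ _ (linfun lowL) (Der F m)).
  suff -> : (linfun lowL @: Der F m)%VS = fullv.
    by rewrite dimvf /dim /= card_gtn_pairs muln1.
  apply/eqP; rewrite eqEsubv subvf; apply/subvP => w _.
  (* Surjectivity: extend [w] by zero to all pairs and antisymmetrize. For a pair in [S] the
     transposed pair lies outside [S], so the subtracted term is the default 0. *)
  pose below i j : F := if insub (i, j) is Some p then w (p : S) else 0.
  pose D0 : 'M[F]_m := \matrix_(i, j) (below i j - below j i).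
  pose A := block_mx (0 : 'M_1) 0 0 D0.
  have DE : Emx (linfun (mulmx A)) = A.
    by apply/matrixP => i j; rewrite mxE lfunE /= -colE mxE.
  apply/memv_imgP; exists (linfun (mulmx A)).
    apply/DerP/derivation_block; exists D0 => //.
    by apply/matrixP => i j; rewrite !mxE opprB.
  rewrite lowE; apply/ffunP => p.
  rewrite ffunE DE (@block_mxEdr _ 1 m 1 m) mxE /below.
  case: p => -[i j] /= ij.
  by rewrite insubT insubF /= ?subr0 // ltnNge ltnW.
(* Injectivity: once the entries below the diagonal vanish, skewness kills those above it and
   characteristic different from 2 kills the diagonal. *)
apply/eqP; rewrite -subv0; apply/subvP => D.
rewrite memv_cap memv_ker lowE memv0 => /andP[/DerP/derivation_block].
case=> D0 skewD0 DE /eqP/ffunP low0.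
have D0_low (i j : 'I_m) : (j < i)%N -> D0 i j = 0.
  move=> ij; have := low0 (exist _ (i, j) ij).
  by rewrite !ffunE DE (@block_mxEdr _ 1 m 1 m).
have D00 : D0 = 0.
  apply/matrixP => i j; rewrite [RHS]mxE.
  have [ij | /D0_low // | /val_inj->] := ltngtP i j.
    by rewrite skewD0 !mxE D0_low ?oppr0.
  exact: skew_mx_diag.
apply/eqP/lfunP => x.
by rewrite Emx_mul DE D00 (@block_mx0 _ 1 m 1 m) mul0mx lfunE.
Qed.
End Derivations.

Theorem lemma32 (F : closedFieldType) (m : nat) (hF : 2%N \notin [pchar F]) :
  (forall D : 'End('cV[F]_m.+1),
     derivation D <->
     exists2 D0 : 'M[F]_m,
       D0 = - D0^T & Emx D = block_mx (0 : 'M_1) 0 0 D0) /\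
  \dim (Der F m) = ((m.+1 - 1) * (m.+1 - 2) %/ 2)%N.
Proof.
split=> [D|]; first exact: derivation_block.
(* The truncated [m.+1 - 2] is harmless at [m = 0], where the other factor is zero. *)
by rewrite dim_Der // bin2 divn2 !subSS subn0 subn1.
Qed.
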